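(* Let $X=\{X(t),\,t\in\mathcal{T}\}$ be a multifractal process with set of scales $\Lambda$, set $\mathcal{S}$ and family of scaling factors $\{M(\lambda,t),\,\lambda\in\Lambda,\,t\in\mathcal{S}\}$. Suppose $\overline{q}(X)>0$ and that for some $t\in\mathcal{S}$ (and hence for every $t\in\mathcal{S}$) the process $\{M(\lambda,t),\,\lambda\in\Lambda\}$ is continuous in law. Suppose also $1\in\mathcal{S}$. Let $L=\{L(s),\,s\ge0\}$ be a Lévy process with $L(1)\overset{d}{=}\log M(e^{-1},t)$ if $\Lambda=(0,1]$ and $L(1)\overset{d}{=}\log M(e,t)$ if $\Lambda=[1,\infty)$, and let $\psi$ be its Laplace exponent. Then for every $q\in(\underline{q}(X),\overline{q}(X))$: - if $\Lambda=(0,1]$, then $$\mathbb{E}|X(t)|^q=t^{-\psi(q)}\,\mathbb{E}|X(1)|^q,\quad t\in(0,1];$$ - if $\Lambda=[1,\infty)$, then $$\mathbb{E}|X(t)|^q=t^{\psi(q)}\,\mathbb{E}|X(1)|^q,\quad t\in[1,\infty).$$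
   Context: All processes are real-valued. $\overset{d}{=}$ denotes equality in law, and $\{\cdot\}\overset{d}{=}\{\cdot\}$ equality of finite dimensional distributions. The time set $\mathcal{T}$ is one of $(0,\infty)$, $[0,\infty)$, $(0,T]$, $[0,T]$, $[T,\infty)$ with $T>0$. Every process is assumed not identically null: there is $t\in\mathcal{T}$, $t\neq0$, with $P(X(t)\neq0)>0$. A process $X=\{X(t),\,t\in\mathcal{T}\}$ is multifractal (with sets $\Lambda\subset(0,\infty)$, $\mathcal{S}\subset\mathcal{T}$) if for every $\lambda\in\Lambda$ there exists a family of identically distributed positive random variables $\{M(\lambda,t),\,t\in\mathcal{S}\}$, independent of the process $\{X(t)\}$, such that $\{X(\lambda t)\}_{t\in\mathcal{S}}\overset{d}{=}\{M(\lambda,t)X(t)\}_{t\in\mathcal{S}}$. The random field $M=\{M(\lambda,t),\,\lambda\in\Lambda,\,t\in\mathcal{S}\}$ is called the family of scaling factors. Standing assumption: either $\Lambda=(0,1]$ or $\Lambda=[1,\infty)$, and $\lambda\mathcal{S}=\{\lambda t:t\in\mathcal{S}\}\subset\mathcal{S}$ for every $\lambda\in\Lambda$. $\overline{q}(X)=\sup\{q\ge0:\ \mathbb{E}|X(t)|^q<\infty\text{ for all }t\in\mathcal{T}\}$ and $\underline{q}(X)=\inf\{q\le0:\ \mathbb{E}|X(t)|^q<\infty\text{ for all }t\in\mathcal{T}\}$. A process $\{Z(\lambda)\}$ is continuous in law if for every $\lambda_0$, $Z(\lambda)\to Z(\lambda_0)$ in distribution as $\lambda\to\lambda_0$. A Lévy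 process is a process starting at zero, with stationary independent increments, and stochastically continuous. The Laplace exponent $\psi$ of $L$ is defined by $\mathbb{E}[e^{qL(s)}]=e^{s\psi(q)}$, $s\ge0$, for those $q$ for which the expectation is finite (equivalently $\psi(q)=\log\mathbb{E}[e^{qL(1)}]$). *)

(* Defs.v *)
From HB Require Import structures.
From mathcomp Require Import all_boot all_order all_algebra.
From mathcomp Require Import all_classical all_reals all_analysis.

Set Implicit Arguments.
Unset Strict Implicit.
Unset Printing Implicit Defensive.

Import Order.TTheory GRing.Theory Num.Theory.
Import numFieldNormedType.Exports.

Local Open Scope classical_set_scope.
Local Open Scope ring_scope.

(* A process on a time set T is a total family X : R -> Omega -> R of which
   only the members X t with T t are ever constrained. *)

Definition is_time_set (R : realType) (T : set R) : Prop :=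
  T = `]0, +oo[%classic \/ T = `[0, +oo[%classic \/
  exists2 T0 : R, 0 < T0 &
    T = `]0, T0]%classic \/ T = `[0, T0]%classic \/ T = `[T0, +oo[%classic.

Definition not_identically_null (R : realType) d (W : measurableType d)
    (P : probability W R) (T : set R) (X : R -> W -> R) : Prop :=
  exists t : R, [/\ T t, t != 0 & (0 < P [set w | X t w != 0%R])%E].

(* The two maps may live on different probability spaces. *)
Definition eq_law (R : realType) d1 (W1 : measurableType d1)
    d2 (W2 : measurableType d2) d (E : measurableType d)
    (P1 : probability W1 R) (Y1 : W1 -> E)
    (P2 : probability W2 R) (Y2 : W2 -> E) : Prop :=
  forall A : set E, measurable A -> P1 (Y1 @^-1` A) = P2 (Y2 @^-1` A).

Definition eq_fdd (R : realType) d1 (W1 : measurableType d1)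
    d2 (W2 : measurableType d2) (I : set R)
    (P1 : probability W1 R) (Y1 : R -> W1 -> R)
    (P2 : probability W2 R) (Y2 : R -> W2 -> R) : Prop :=
  forall (n : nat) (t : 'I_n -> R), (forall i, I (t i)) ->
    eq_law P1 (fun w => [tuple Y1 (t i) w | i < n])
           P2 (fun w => [tuple Y2 (t i) w | i < n]).

Definition sigma_process (R : realType) d (W : measurableType d)
    (I : set R) (Y : R -> W -> R) : set (set W) :=
  <<s \bigcup_(t in I) preimage_set_system setT (Y t) measurable >>.

Definition independent_processes (R : realType) d (W : measurableType d)
    (P : probability W R) (I : set R) (Y : R -> W -> R)
    (J : set R) (Z : R -> W -> R) : Prop :=
  forall A B : set W, sigma_process I Y A -> sigma_process J Z B ->
    P (A `&` B) = (P A * P B)%E.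

(* X is multifractal on T with sets Lambda and S, and M lam t are its scaling
   factors.  Nothing is assumed on the joint law of M lam and M mu when
   lam <> mu.  Positivity is almost sure. *)
Record multifractal_with (R : realType) d (W : measurableType d)
    (P : probability W R) (T : set R) (X : R -> W -> R)
    (Lambda S : set R) (M : R -> R -> W -> R) : Prop := MultifractalWith {
  scales_gt0 : Lambda `<=` `]0, +oo[%classic ;
  times_sub : S `<=` T ;
  factors_id : forall lam s t : R, Lambda lam -> S s -> S t ->
    eq_law P (M lam s) P (M lam t) ;
  factors_gt0 : forall lam t : R, Lambda lam -> S t ->
    {ae P, forall w, 0 < M lam t w} ;
  factors_indep : forall lam : R, Lambda lam ->
    independent_processes P S (M lam) T X ;
  scaling : forall lam : R, Lambda lam ->
    eq_fdd S P (fun t => X (lam * t)) P (fun t w => M lam t w * X t w)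
}.

Definition admissible_scales (R : realType) (Lambda S : set R) : Prop :=
  (Lambda = `]0, 1]%classic \/ Lambda = `[1, +oo[%classic) /\
  forall lam t : R, Lambda lam -> S t -> S (lam * t).

(* |x|^q with values in [0, +oo]: the library's powR gives 0 `^ q = 0 for
   q < 0, whereas a negative moment requires 0 ^ q = +oo. *)
Definition abs_pow (R : realType) (q x : R) : \bar R :=
  if (x == 0) && (q < 0) then +oo%E else (`|x| `^ q)%:E.

Definition abs_moment (R : realType) d (W : measurableType d)
    (P : probability W R) (q : R) (Y : W -> R) : \bar R :=
  (\int[P]_w abs_pow q (Y w))%E.

Definition qsup (R : realType) d (W : measurableType d)
    (P : probability W R) (T : set R) (X : R -> W -> R) : \bar R :=
  ereal_sup [set q%:E | q in
    [set q : R | 0 <= q /\ forall t, T t -> (abs_moment P q (X t) < +oo)%E]].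

Definition qinf (R : realType) d (W : measurableType d)
    (P : probability W R) (T : set R) (X : R -> W -> R) : \bar R :=
  ereal_inf [set q%:E | q in
    [set q : R | q <= 0 /\ forall t, T t -> (abs_moment P q (X t) < +oo)%E]].

Definition continuous_in_law (R : realType) d (W : measurableType d)
    (P : probability W R) (I : set R) (Z : R -> W -> R) : Prop :=
  forall lam0 : R, I lam0 ->
  forall f : R -> R, continuous f -> bounded_fun f ->
    ('E_P[f \o Z lam])%E @[lam --> within I (nbhs lam0)] -->
    ('E_P[f \o Z lam0])%E.

Record levy_process (R : realType) d (W : measurableType d)
    (P : probability W R) (L : R -> W -> R) : Prop := LevyProcess {
  levy0 : {ae P, forall w, L 0 w = 0} ;
  levy_stationary : forall s h : R, 0 <= s -> 0 <= h ->
    eq_law P (fun w => L (s + h) w - L s w) P (fun w => L h w - L 0 w) ;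
  levy_indep : forall (n : nat) (t : nat -> R) (B : nat -> set R),
    0 <= t 0%N -> {homo t : i j / (i <= j)%N >-> i <= j} ->
    (forall i, measurable (B i)) ->
    P (\bigcap_(i < n) [set w | B i (L (t i.+1) w - L (t i) w)]) =
    (\prod_(i < n) P [set w | B i (L (t i.+1) w - L (t i) w)%R])%E ;
  levy_continuous : forall s : R, 0 <= s -> forall eps : R, 0 < eps ->
    P [set w | eps < `|L u w - L s w|]
      @[u --> within `[0, +oo[%classic (nbhs s)] --> 0%E
}.

(* psi is constrained only at those q for which the exponential moment is
   finite.  A statement quantified over all such psi which asserts something
   about psi q therefore cannot rely on a default value where the moment is
   infinite. *)
Definition laplace_exponent (R : realType) d (W : measurableType d)
    (P : probability W R) (L : R -> W -> R) (psi : R -> R) : Prop :=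
  forall q s : R, 0 <= s -> ('M_P (L s) q < +oo)%E ->
    'M_P (L s) q = (expR (s * psi q))%:E.

(* Main.v *)
Require Import Defs.
From HB Require Import structures.
From mathcomp Require Import all_boot all_order all_algebra.
From mathcomp Require Import all_classical all_reals all_analysis.
From mathcomp Require Import measurable_realfun ring lra.

Set Implicit Arguments.
Unset Strict Implicit.
Unset Printing Implicit Defensive.

Import Order.TTheory GRing.Theory Num.Theory.
Import numFieldNormedType.Exports.

Local Open Scope classical_set_scope.
Local Open Scope ring_scope.

(** Fix q strictly between qinf and qsup, and write m(t) = E|X(t)|^q and
    g(lambda) = E[M(lambda, t0)^q].

    Since M(lambda, .) is independent of X and the law of M(lambda, t) does not
    depend on t, the scaling relation at the single time t gives
    m(lambda t) = g(lambda) m(t) in [0, +oo] (abs_moment_scaling).  At t = 1 and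
    t = mu, together with m(lambda mu) = g(lambda mu) m(1), this yields
    g(lambda mu) m(1) = g(lambda) g(mu) m(1).  If m(1) = 0 the theorem reads
    0 = 0.  Otherwise m(1) is positive, and finite by the choice of q, so g is
    positive, finite and multiplicative on the set of scales.

    Along lambda = exp(sg s), with s >= 0 and sg = -1 or sg = 1, the function
    s |-> ln g(exp(sg s)) is therefore additive on [0, +oo[.  An additive
    function bounded below near 0 is linear
    (additive_bounded_below_linear).  The bound comes from continuity in law at
    lambda = 1: x^q dominates a continuous bounded function of x which is
    positive on ]0, +oo[, and whose expectation at lambda is thus bounded away
    from 0 for lambda near 1 (abs_moment_lower_bound).

    The slope is read off at s = 1, where
    g(e^sg) = E[e^(q ln M(e^sg, t0))] = E[e^(q L(1))] = e^(psi q).  Hence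
    m(e^(sg s)) = e^(s psi(q)) m(1); substituting s = sg ln t gives both power
    laws. *)

(** * Additive functions on the half-line *)

(** Subtracting the linear function with the same value at 1 leaves an additive
    g vanishing on the natural numbers.  A lower bound for g on [0, delta]
    spreads to [0, 1] by dividing the argument, and then to [0, +oo[ because
    g (k + r) = g r for natural k.  Additivity turns any lower bound on the
    whole half-line into g >= 0, and g s + g (k - s) = 0 for a natural k >= s
    forces g s = 0. *)
Lemma additive_bounded_below_linear (R : realType) (f : R -> R) (delta K : R) :
  (forall s t, 0 <= s -> 0 <= t -> f (s + t) = f s + f t) ->
  0 < delta -> (forall s, 0 <= s -> s <= delta -> - K <= f s) ->
  forall s, 0 <= s -> f s = s * f 1.
Proof.
move=> fD delta0 fK.
pose g s := f s - s * f 1.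
have gD s t : 0 <= s -> 0 <= t -> g (s + t) = g s + g t.
  by move=> s0 t0; rewrite /g fD//; ring.
have g0 : g 0 = 0 by have := gD 0 0 (lexx _) (lexx _); rewrite addr0; lra.
have gM n s : 0 <= s -> g (n%:R * s) = n%:R * g s.
  move=> s0; elim: n => [|n IHn]; first by rewrite !mul0r.
  rewrite -natr1 !mulrDl !mul1r gD ?IHn//.
  by rewrite mulr_ge0.
have gn n : g n%:R = 0.
  by rewrite -[n%:R]mulr1 gM// /g mul1r subrr mulr0.
(* 1/N < delta, so that s/N lies in [0, delta] for s in [0, 1]. *)
pose N := (Num.trunc delta^-1).+1.
have N0 : 0 < N%:R :> R by rewrite ltr0n.
have Ndelta : N%:R^-1 < delta.
  rewrite -[ltRHS]invrK ltf_pV2 ?posrE ?invr_gt0//.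
  by rewrite /N; exact: Num.Theory.truncnS_gt.
pose K' := N%:R * (K + `|f 1|).
have g_frac s : 0 <= s -> s <= 1 -> - K' <= g s.
  move=> s0 s1.
  have -> : s = N%:R * (s / N%:R) by field; rewrite gt_eqF.
  have sN0 : 0 <= s / N%:R by rewrite divr_ge0 ?ler0n.
  have sN1 : s / N%:R <= 1.
    by rewrite ler_pdivrMr// mul1r (le_trans s1)// ler1n.
  have sNd : s / N%:R <= delta.
    rewrite (le_trans _ (ltW Ndelta))// ler_pdivrMr// mulVf ?gt_eqF//.
  rewrite gM// /K' -mulrN ler_pM2l// /g opprD lerD ?fK// lerN2.
  rewrite (le_trans (ler_norm _))// normrM ger0_norm// ler_piMl//.
have g_lb s : 0 <= s -> - K' <= g s.
  move=> s0.
  have tr : (Num.trunc s)%:R <= s by rewrite truncn_le.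
  have tr1 : s <= (Num.trunc s)%:R + 1 by rewrite natr1 ltW// truncnS_gt.
  have -> : s = (Num.trunc s)%:R + (s - (Num.trunc s)%:R) by lra.
  by rewrite gD ?ler0n ?subr_ge0// gn add0r g_frac//; lra.
have g_ge0 s : 0 <= s -> 0 <= g s.
  move=> s0; rewrite leNgt; apply/negP => gs.
  pose n := (Num.trunc (K' / - g s)).+1.
  have := g_lb (n%:R * s) (mulr_ge0 (ler0n _ _) s0).
  rewrite gM// leNgt => /negP; apply.
  rewrite -[ltLHS]opprK ltrN2 -mulrN -ltr_pdivrMr ?oppr_gt0//.
  exact: truncnS_gt.
move=> s s0; apply/eqP; rewrite -subr_eq0 -/(g s) eq_le g_ge0// andbT.
have tr1 : s <= (Num.trunc s).+1%:R by rewrite ltW// truncnS_gt.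
have := gn (Num.trunc s).+1.
have -> : (Num.trunc s).+1%:R = s + ((Num.trunc s).+1%:R - s) :> R by ring.
rewrite gD ?subr_ge0//.
by have := g_ge0 ((Num.trunc s).+1%:R - s); rewrite subr_ge0 => /(_ tr1); lra.
Qed.

(** * Equality in law and independence *)

Lemma eq_law_ge0_integral (R : realType) d1 (W1 : measurableType d1)
    d2 (W2 : measurableType d2) d (E : measurableType d)
    (P1 : probability W1 R) (P2 : probability W2 R)
    (Y1 : W1 -> E) (Y2 : W2 -> E) (f : E -> \bar R) :
  measurable_fun setT Y1 -> measurable_fun setT Y2 ->
  measurable_fun setT f -> (forall x, 0 <= f x)%E ->
  eq_law P1 Y1 P2 Y2 ->
  (\int[P1]_w f (Y1 w) = \int[P2]_w f (Y2 w))%E.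
Proof.
move=> mY1 mY2 mf f0 Y12.
transitivity (\int[pushforward P1 Y1]_x f x)%E.
  by rewrite ge0_integral_pushforward.
transitivity (\int[pushforward P2 Y2]_x f x)%E; last first.
  by rewrite ge0_integral_pushforward.
by apply: eq_measure_integral => A mA _; exact: Y12.
Qed.

(** Independence says that the law of (Y, Z) agrees with the product of the two
    marginal laws on rectangles, hence everywhere; Tonelli then separates the
    variables. *)
Lemma independent_ge0_integralM (R : realType) d (W : measurableType d)
    (P : probability W R) d1 (E1 : measurableType d1)
    d2 (E2 : measurableType d2) (Y : W -> E1) (Z : W -> E2)
    (f : E1 -> \bar R) (g : E2 -> \bar R) :
  measurable_fun setT Y -> measurable_fun setT Z ->
  (forall A B, measurable A -> measurable B ->
    P (Y @^-1` A `&` Z @^-1` B) = (P (Y @^-1` A) * P (Z @^-1` B))%E) ->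
  measurable_fun setT f -> measurable_fun setT g ->
  (forall x, 0 <= f x)%E -> (forall x, 0 <= g x)%E ->
  (\int[P]_w (f (Y w) * g (Z w)) =
   (\int[P]_w f (Y w)) * (\int[P]_w g (Z w)))%E.
Proof.
move=> mY mZ YZ mf mg f0 g0.
pose Y' : {mfun W >-> E1} := HB.pack Y (isMeasurableFun.Build _ _ _ _ Y mY).
pose Z' : {mfun W >-> E2} := HB.pack Z (isMeasurableFun.Build _ _ _ _ Z mZ).
pose muY := distribution P Y'.
pose muZ := distribution P Z'.
have mYZ : measurable_fun setT (fun w => (Y w, Z w)).
  exact: measurable_fun_pair.
pose h (z : E1 * E2) := (f z.1 * g z.2)%E.
have mh : measurable_fun setT h.
  by apply: emeasurable_funM; exact: measurableT_comp.
have h0 z : (0 <= h z)%E by exact: mule_ge0.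
transitivity (\int[pushforward P (fun w => (Y w, Z w))]_z h z)%E.
  by rewrite ge0_integral_pushforward.
transitivity (\int[muY \x muZ]_z h z)%E.
  apply: eq_measure_integral => A mA _; apply/esym.
  by apply: product_measure_unique => // B C mB mC; exact: YZ.
rewrite fubini_tonelli1//.
transitivity (\int[muY]_x (f x * \int[muZ]_y g y))%E.
  by apply: eq_integral => x _; rewrite /fubini_F /h/= ge0_integralZl.
rewrite ge0_integralZr//; last exact: integral_ge0.
by rewrite !ge0_integral_distribution.
Qed.

Lemma eq_fdd_marginal (R : realType) d1 (W1 : measurableType d1)
    d2 (W2 : measurableType d2) (I : set R)
    (P1 : probability W1 R) (Y1 : R -> W1 -> R)
    (P2 : probability W2 R) (Y2 : R -> W2 -> R) (t : R) :
  eq_fdd I P1 Y1 P2 Y2 -> I t -> eq_law P1 (Y1 t) P2 (Y2 t).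
Proof.
move=> Y12 It A mA.
have /(_ ((fun x : 1.-tuple R => tnth x ord0) @^-1` A)) :=
  Y12 1%N (fun=> t) (fun=> It).
have mtA : measurable ((fun x : 1.-tuple R => tnth x ord0) @^-1` A).
  by rewrite -[X in measurable X]setTI; exact: measurable_tnth.
move=> /(_ mtA); congr (P1 _ = P2 _).
all: by apply/seteqP; split => w /=; rewrite tnth_mktuple.
Qed.

Lemma independent_processes_marginal (R : realType) d (W : measurableType d)
    (P : probability W R) (I J : set R) (Y Z : R -> W -> R) (s t : R)
    (A B : set R) :
  independent_processes P I Y J Z -> I s -> J t ->
  measurable A -> measurable B ->
  P (Y s @^-1` A `&` Z t @^-1` B) = (P (Y s @^-1` A) * P (Z t @^-1` B))%E.
Proof.
move=> YZ Is Jt mA mB; apply: YZ; apply: sub_sigma_algebra.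
- by exists s => //; exists A => //; rewrite setTI.
- by exists t => //; exists B => //; rewrite setTI.
Qed.

Lemma ae_gt0_integral_gt0 (R : realType) d (W : measurableType d)
    (P : probability W R) (f : W -> \bar R) :
  measurable_fun setT f -> (forall w, 0 <= f w)%E ->
  {ae P, forall w, (0 < f w)%E} -> (0 < \int[P]_w f w)%E.
Proof.
move=> mf f0 fpos; rewrite lt0e integral_ge0// andbT; apply/eqP => If0.
have /(ae_eq_integral_abs P measurableT mf) fae :
    (\int[P]_w `|f w| = 0)%E.
  by rewrite -[RHS]If0; apply: eq_integral => w _; rewrite gee0_abs.
have : {ae P, forall w : W, False}.
  apply: filterS2 fae fpos => w /(_ I) /= ->.
  by rewrite ltxx.
case=> N [mN PN sub].
have NT : N = setT by apply/seteqP; split => // w _; exact: sub.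
by move: PN; rewrite NT probability_setT => /eqP; rewrite onee_eq0.
Qed.

(** * Absolute moments *)

Lemma abs_pow_ge0 (R : realType) (q x : R) : (0 <= abs_pow q x)%E.
Proof. by rewrite /abs_pow; case: ifP => // _; rewrite lee_fin powR_ge0. Qed.

Lemma abs_pow_gt0 (R : realType) (q x : R) : x != 0 -> (0 < abs_pow q x)%E.
Proof.
by move=> x0; rewrite /abs_pow (negbTE x0)/= lte_fin powR_gt0// normr_gt0.
Qed.

Lemma measurable_abs_pow (R : realType) (q : R) :
  measurable_fun setT (abs_pow q).
Proof.
apply: measurable_fun_ifT => //=.
- apply: measurable_and => //.
  exact: measurable_fun_eqr.
- apply/measurable_EFinP.
  exact: (measurableT_comp (measurable_powR q) (@normr_measurable R setT)).
Qed.

(** With |0|^q = +oo for q < 0 and 0 * +oo = 0, the only delicate case is q < 0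
    with a zero factor, where the other factor |y|^q is positive, possibly
    infinite, so that both sides are +oo. *)
Lemma abs_powM (R : realType) (q x y : R) :
  abs_pow q (x * y) = (abs_pow q x * abs_pow q y)%E.
Proof.
rewrite /abs_pow mulf_eq0.
have [q0|q0] := ltP q 0; last first.
  by rewrite !andbF normrM powRM// EFinM.
rewrite !andbT; have [->|x0]/= := eqVneq x 0.
  have [_|y0] := eqVneq y 0; first by rewrite mulyy.
  by rewrite gt0_mulye// lte_fin powR_gt0// normr_gt0.
have [_|y0] := eqVneq y 0; last by rewrite normrM powRM// EFinM.
by rewrite gt0_muley// lte_fin powR_gt0// normr_gt0.
Qed.

Lemma abs_moment_ge0 (R : realType) d (W : measurableType d)
    (P : probability W R) (q : R) (Y : W -> R) : (0 <= abs_moment P q Y)%E.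
Proof. by apply: integral_ge0 => w _; exact: abs_pow_ge0. Qed.

Lemma abs_moment_law (R : realType) d1 (W1 : measurableType d1)
    d2 (W2 : measurableType d2) (P1 : probability W1 R)
    (P2 : probability W2 R) (Y1 : W1 -> R) (Y2 : W2 -> R) (q : R) :
  measurable_fun setT Y1 -> measurable_fun setT Y2 ->
  eq_law P1 Y1 P2 Y2 -> abs_moment P1 q Y1 = abs_moment P2 q Y2.
Proof.
move=> mY1 mY2; apply: eq_law_ge0_integral => //; last exact: abs_pow_ge0.
exact: measurable_abs_pow.
Qed.

(** If q * ln |x| <= 0 then |x|^q <= 1.  Otherwise ln |x| has the sign of q, so
    moving the exponent from q away from 0 to q' increases q * ln |x|. *)
Lemma abs_pow_interpolation (R : realType) (q q' x : R) :
  0 <= q <= q' \/ q' <= q <= 0 -> (abs_pow q x <= 1 + abs_pow q' x)%E.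
Proof.
have [->|x0] := eqVneq x 0.
  rewrite /abs_pow eqxx normr0 /=.
  case=> /andP[q0 qq'].
    rewrite !ltNge q0 (le_trans q0 qq')/= -EFinD lee_fin.
    rewrite /powR eqxx (@le_trans _ _ 1) ?lerDl//.
    by case: (q == 0); rewrite ?ler01.
  have [q'0|q'0] := ltP q' 0; first by rewrite addey// leey.
  have -> : q = 0 by apply/le_anti; rewrite qq' (le_trans q'0).
  by rewrite ltxx powRr0 -EFinD lee_fin lerDl powR_ge0.
move=> qq'; rewrite /abs_pow (negbTE x0)/= -EFinD lee_fin.
have nx0 : 0 < `|x| by rewrite normr_gt0.
rewrite /powR gt_eqF//.
have [l0|l0] : q * ln `|x| <= 0 \/ q * ln `|x| <= q' * ln `|x|.
  by case: (leP 0 (ln `|x|)) => ?; case: qq' => /andP[? ?]; nra.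
- by rewrite (@le_trans _ _ 1) ?lerDl ?expR_ge0// -expR0 ler_expR.
- by rewrite (@le_trans _ _ (expR (q' * ln `|x|))) ?lerDr// ler_expR.
Qed.

Lemma abs_moment_interpolation (R : realType) d (W : measurableType d)
    (P : probability W R) (q q' : R) (Y : W -> R) :
  measurable_fun setT Y -> 0 <= q <= q' \/ q' <= q <= 0 ->
  (abs_moment P q' Y < +oo)%E -> (abs_moment P q Y < +oo)%E.
Proof.
move=> mY qq' Yq'.
have m r : measurable_fun setT (fun w => abs_pow r (Y w)).
  exact: (measurableT_comp (measurable_abs_pow r)).
apply: (@le_lt_trans _ _ (\int[P]_w (1 + abs_pow q' (Y w)))%E).
  apply: ge0_le_integral => //.
  - by move=> w _; exact: abs_pow_ge0.
  - exact: emeasurable_funD.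
  - by move=> w _; exact: abs_pow_interpolation.
rewrite ge0_integralD//; last by move=> w _; exact: abs_pow_ge0.
rewrite integral_cst// mul1e lte_add_pinfty//.
by rewrite (le_lt_trans (probability_le1 P measurableT))// ltry.
Qed.

Lemma abs_moment_finite (R : realType) d (W : measurableType d)
    (P : probability W R) (T : set R) (X : R -> W -> R) (q t : R) :
  (forall u, T u -> measurable_fun setT (X u)) ->
  (qinf P T X < q%:E)%E -> (q%:E < qsup P T X)%E -> T t ->
  (abs_moment P q (X t) < +oo)%E.
Proof.
move=> mX /ereal_inf_lt[_ [r [r0 rfin] <-]] + /ereal_sup_gt[_ [p [p0 pfin] <-]].
rewrite !lte_fin => rq qp Tt.
have [q0|q0] := leP 0 q.
- apply: (@abs_moment_interpolation _ _ _ _ _ p); [exact: mX| |exact: pfin].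
  by left; rewrite q0 ltW.
- apply: (@abs_moment_interpolation _ _ _ _ _ r); [exact: mX| |exact: rfin].
  by right; rewrite !ltW.
Qed.

(** * Moments along a family that is continuous in law *)

(** A test function below every power x^q with |q| <= n: the quotient
    x / (1 + x^2) is at most the minimum of x and 1/x, that is e^(- |ln x|). *)
Definition bump (R : realType) (n : nat) (x : R) : R :=
  (Num.max x 0 / (1 + x ^+ 2)) ^+ n.

Lemma bump_bounds (R : realType) n (x : R) : 0 <= bump n x <= 1.
Proof.
have d0 : 0 < 1 + x ^+ 2 by rewrite ltr_pwDl ?sqr_ge0.
have m0 : 0 <= Num.max x 0 by rewrite le_max lexx orbT.
rewrite /bump exprn_ge0 ?divr_ge0// ?(ltW d0)//=.
rewrite exprn_ile1 ?divr_ge0 ?(ltW d0)//.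
rewrite ler_pdivrMr// mul1r ge_max (ltW d0) andbT.
by have := sqr_ge0 (x - 1); have := sqr_ge0 x; nra.
Qed.

Lemma continuous_bump (R : realType) n : continuous (@bump R n).
Proof.
move=> x; apply: (@continuous_comp _ _ _
  (fun y : R => Num.max y 0 / (1 + y ^+ 2)) (fun y => y ^+ n)); last first.
  exact: exprn_continuous.
apply: cvgM.
- apply: (@normed_module.continuous_max R R id (cst 0) x) => //.
  exact: cvg_cst.
- apply: cvgV; first by rewrite gt_eqF// ltr_pwDl ?sqr_ge0.
  by apply: cvgD; [exact: cvg_cst|exact: exprn_continuous].
Qed.

Lemma bump_gt0 (R : realType) n (x : R) : 0 < x -> 0 < bump n x.
Proof.
move=> x0; rewrite exprn_gt0// divr_gt0 ?lt_max ?x0//.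
by rewrite ltr_pwDl ?sqr_ge0.
Qed.

Lemma bump_le_powR (R : realType) n (q x : R) :
  `|q| <= n%:R -> 0 < x -> bump n x <= x `^ q.
Proof.
move=> qn x0.
have d0 : 0 < 1 + x ^+ 2 by rewrite ltr_pwDl ?sqr_ge0.
rewrite /bump (max_idPl (ltW x0)).
have h0 : 0 < x / (1 + x ^+ 2) by rewrite divr_gt0.
rewrite -[leLHS]powR_mulrn ?(ltW h0)// /powR !gt_eqF// ler_expR.
have lnh : ln (x / (1 + x ^+ 2)) <= - `|ln x|.
  rewrite lerNr ler_norml; apply/andP; split.
    rewrite opprK ler_ln ?posrE// ler_pdivrMr// ler_peMr ?(ltW x0)//.
    by rewrite lerDl sqr_ge0.
  rewrite -lnV ?posrE// ler_ln ?posrE ?invr_gt0// invf_div.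
  by rewrite ler_pdivlMr// -expr2 lerDr.
apply: (@le_trans _ _ (n%:R * - `|ln x|)); first by rewrite ler_wpM2l.
rewrite mulrN lerNl (le_trans (ler_norm _))// normrN normrM.
by rewrite ler_wpM2r.
Qed.

(** Continuity in law controls bounded continuous test functions only, whereas
    |x|^q may be unbounded both at 0 and at infinity; minorizing it by a
    positive bump is enough to keep the moments away from 0. *)
Lemma abs_moment_lower_bound (R : realType) d (W : measurableType d)
    (P : probability W R) (I : set R) (Z : R -> W -> R) (lam0 q : R) :
  (forall lam, I lam -> measurable_fun setT (Z lam)) ->
  (forall lam, I lam -> {ae P, forall w, 0 < Z lam w}) ->
  continuous_in_law P I Z -> I lam0 ->
  exists2 a : R, 0 < a &
    \forall lam \near nbhs lam0, I lam -> (a%:E <= abs_moment P q (Z lam))%E.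
Proof.
move=> mZ Zpos Zc I0.
pose n := (Num.trunc `|q|).+1.
have qn : `|q| <= n%:R by rewrite ltW// truncnS_gt.
have bb : bounded_fun (@bump R n).
  exists 1; split => // y y1 x _ /=; have /andP[b0 b1] := bump_bounds n x.
  by rewrite ger0_norm// (le_trans b1)// ltW.
have Ec := Zc _ I0 _ (@continuous_bump R n) bb.
have mb : measurable_fun setT (@bump R n).
  by apply: continuous_measurable_fun; exact: continuous_bump.
have mbZ lam : I lam -> measurable_fun setT (fun w => (bump n (Z lam w))%:E).
  move=> Il; apply/measurable_EFinP.
  by apply: (measurableT_comp mb); exact: mZ.
have bZ0 lam w : (0 <= (bump n (Z lam w))%:E)%E.
  by rewrite lee_fin; have /andP[] := bump_bounds n (Z lam w).
have E0 : (0 < 'E_P[@bump R n \o Z lam0])%E.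
  rewrite unlock; apply: ae_gt0_integral_gt0; [exact: mbZ|exact: bZ0|].
  by apply: filterS (Zpos _ I0) => w; rewrite lte_fin; exact: bump_gt0.
have [a a0 aE] : exists2 a : R, 0 < a & (a%:E < 'E_P[@bump R n \o Z lam0])%E.
  move: E0; case: ('E_P[@bump R n \o Z lam0])%E => [r||] //;
    last by exists 1; rewrite ?ltry.
  by rewrite lte_fin => r0; exists (r / 2); rewrite ?lte_fin; lra.
exists a => //.
have nb : nbhs ('E_P[@bump R n \o Z lam0])%E [set y | (a%:E < y)%E].
  by apply: open_nbhs_nbhs; split; first exact: open_ereal_gt_ereal.
have := Ec _ nb.
rewrite /= /nbhs/= /within/=.
apply: filterS => lam /= H Il.
rewrite (le_trans (ltW (H Il)))// unlock.
apply: ae_ge0_le_integral => //.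
- by move=> w _; exact: bZ0.
- exact: mbZ.
- by move=> w _; exact: abs_pow_ge0.
- by apply: (measurableT_comp (measurable_abs_pow q)); exact: mZ.
- apply: filterS (Zpos _ Il) => w Zw _.
  by rewrite /abs_pow (gt_eqF Zw)/= lee_fin gtr0_norm// bump_le_powR.
Qed.

(** * Moments of a multifractal process *)

Section ScalingOfMoments.
Context (R : realType) (d : measure_display) (W : measurableType d)
  (P : probability W R) (T Lambda S : set R)
  (X : R -> {RV P >-> R}) (M : R -> R -> {RV P >-> R})
  (XM : multifractal_with P T X Lambda S M).

(** The factor on the right may be taken at any time t0: only its law, which is
    the same at all times, enters. *)
Lemma abs_moment_scaling (q lam t0 t : R) : Lambda lam -> S t0 -> S t ->
  abs_moment P q (X (lam * t)) =
  (abs_moment P q (M lam t0) * abs_moment P q (X t))%E.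
Proof.
move=> Ll St0 St.
have Tt := times_sub XM St.
have mM s : measurable_fun setT (M lam s) by exact: measurable_funPT.
have mX s : measurable_fun setT (X s) by exact: measurable_funPT.
have mq := measurable_abs_pow q.
have law := eq_fdd_marginal (scaling XM Ll) St.
rewrite (abs_moment_law _ _ _ law)//; last exact: measurable_funM.
rewrite (abs_moment_law _ _ _ (factors_id XM Ll St0 St))//.
rewrite /abs_moment; under eq_integral do rewrite abs_powM.
apply: (independent_ge0_integralM (mM t) (mX t) _ mq mq);
  [|exact: abs_pow_ge0..].
by move=> A B; exact: (independent_processes_marginal (factors_indep XM Ll)).
Qed.

(** The nonzero q-th moment at time 1 can be cancelled, which makes the moment
    of the factor multiplicative in the scale; its logarithm is then additive
    along the semigroup of scales e^(sg s) and bounded below near s = 0. *)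
Lemma abs_moment_exp_scaling (q sg t0 : R) :
  (forall lam t, Lambda lam -> S t -> S (lam * t)) ->
  S t0 -> S 1 -> continuous_in_law P Lambda (fun lam => M lam t0) ->
  (forall s : R, 0 <= s -> Lambda (expR (sg * s))) ->
  (qinf P T X < q%:E)%E -> (q%:E < qsup P T X)%E ->
  abs_moment P q (X 1) != 0%E ->
  exists c : R, forall s : R, 0 <= s ->
    abs_moment P q (M (expR (sg * s)) t0) = (expR (s * c))%:E.
Proof.
move=> SM St0 S1 Mc Lsg qi qs m1_neq0.
have mX t : T t -> measurable_fun setT (X t).
  by move=> _; exact: measurable_funPT.
have mfin t : S t -> (abs_moment P q (X t) < +oo)%E.
  by move=> St; apply: (abs_moment_finite mX qi qs); exact: (times_sub XM).
pose m t := fine (abs_moment P q (X t)).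
have mE t : S t -> abs_moment P q (X t) = (m t)%:E.
  by move=> St; rewrite fineK// ge0_fin_numE ?abs_moment_ge0// mfin.
have m1 : 0 < m 1.
  by rewrite fine_gt0// mfin// lt0e m1_neq0 abs_moment_ge0.
pose g s := fine (abs_moment P q (M (expR (sg * s)) t0)).
have Mpos lam : Lambda lam -> (0 < abs_moment P q (M lam t0))%E.
  move=> Ll; apply: ae_gt0_integral_gt0.
  - apply: (measurableT_comp (measurable_abs_pow q)).
    exact: measurable_funPT.
  - by move=> w; exact: abs_pow_ge0.
  - apply: filterS (factors_gt0 XM Ll St0) => w M0.
    by rewrite abs_pow_gt0// gt_eqF.
have Mfin (s : R) : 0 <= s ->
    abs_moment P q (M (expR (sg * s)) t0) \is a fin_num.
  move=> s0; rewrite ge0_fin_numE ?abs_moment_ge0//.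
  have Ll := Lsg _ s0.
  have /mfin := SM _ _ Ll S1.
  rewrite (abs_moment_scaling q Ll St0 S1) mE//.
  case: (abs_moment P q (M _ t0)) => [r _||//]; first by rewrite ltry.
  by rewrite gt0_mulye ?lte_fin.
have gE (s : R) : 0 <= s -> abs_moment P q (M (expR (sg * s)) t0) = (g s)%:E.
  by move=> s0; rewrite fineK// Mfin.
have g0 (s : R) : 0 <= s -> 0 < g s.
  by move=> s0; rewrite -lte_fin -gE// Mpos//; exact: Lsg.
(* Kept transparent, g would be unfolded into integrals when matching the
   patterns below. *)
clearbody m g.
have gD (s t : R) : 0 <= s -> 0 <= t -> g (s + t) = g s * g t.
  move=> s0 t_ge0.
  have Ls := Lsg _ s0; have Lt := Lsg _ t_ge0.
  have Lst := Lsg _ (addr_ge0 s0 t_ge0).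
  have st0 := addr_ge0 s0 t_ge0.
  apply: (mulIf (lt0r_neq0 m1)); apply: EFin_inj.
  rewrite -mulrA !EFinM -(gE _ s0) -(gE _ t_ge0) -(gE _ st0) -(mE _ S1).
  apply: (etrans (esym (abs_moment_scaling q Lst St0 S1))).
  have -> : expR (sg * (s + t)) * 1 = expR (sg * s) * (expR (sg * t) * 1).
    by rewrite mulrDr expRD mulrA.
  apply: (etrans (abs_moment_scaling q Ls St0 (SM _ _ Lt S1))).
  by congr (_ * _)%E; exact: abs_moment_scaling.
have L1 : Lambda 1 by have := Lsg 0 (lexx _); rewrite mulr0 expR0.
have [a a0 near1] := @abs_moment_lower_bound _ _ _ P _ (fun lam => M lam t0)
  1 q (fun lam _ => measurable_funPT (M lam t0))
  (fun lam Ll => factors_gt0 XM Ll St0) Mc L1.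
have [delta delta0 Hdelta] : exists2 delta, 0 < delta &
    forall s : R, 0 <= s -> s <= delta -> ln a <= ln (g s).
  have : \forall s \near nbhs (0 : R), Lambda (expR (sg * s)) ->
      (a%:E <= abs_moment P q (M (expR (sg * s)) t0))%E.
    have ec : (fun s : R => expR (sg * s)) @ nbhs (0 : R) --> (1 : R).
      have -> : 1 = expR (sg * 0) by rewrite mulr0 expR0.
      apply: (@continuous_comp _ _ _ (fun s : R => sg * s) expR).
        exact: mulrl_continuous.
      exact: continuous_expR.
    exact: ec near1.
  move=> /nbhs_ballP[e /= e0 He]; exists (e / 2); first by rewrite divr_gt0.
  move=> s s0 se; rewrite ler_ln ?posrE ?g0//.
  rewrite -lee_fin -gE//; apply: He; last exact: Lsg.
  by rewrite /ball/= sub0r normrN ger0_norm//; lra.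
exists (ln (g 1)) => s s0.
rewrite gE// -[s * _](@additive_bounded_below_linear _ (fun u => ln (g u))
  delta (- ln a))//; first by rewrite lnK// posrE g0.
- by move=> u v u0 v0; rewrite gD// lnM// posrE g0.
- by move=> u u0 ud; rewrite opprK Hdelta.
Qed.

Lemma mmt_ln_abs_moment (lam t0 q : R) d' (W' : measurableType d')
    (P' : probability W' R) (Y : {RV P' >-> R}) :
  Lambda lam -> S t0 ->
  eq_law P' Y P (fun w => ln (M lam t0 w)) ->
  'M_P' Y q = abs_moment P q (M lam t0).
Proof.
move=> Ll St0 law; rewrite /mmt_gen_fun unlock.
have mexp : measurable_fun setT (fun x : R => (expR (q * x))%:E).
  apply/measurable_EFinP.
  exact: (measurableT_comp (@measurable_expR R) (@mulrl_measurable R setT q)).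
have mlnM : measurable_fun setT (fun w => ln (M lam t0 w)).
  apply: measurableT_comp; first exact: measurable_ln.
  exact: measurable_funPT.
transitivity (\int[P']_w (expR (q * Y w))%:E)%E.
  by apply: eq_integral => w _ /=; rewrite mulrC.
rewrite (eq_law_ge0_integral (f := fun x => (expR (q * x))%:E)
  _ mlnM mexp _ law).
- apply: ge0_ae_eq_integral => //.
  + exact: (measurableT_comp mexp mlnM).
  + apply: (measurableT_comp (measurable_abs_pow q)).
    exact: measurable_funPT.
  + by move=> w _; exact: abs_pow_ge0.
  + apply: filterS (factors_gt0 XM Ll St0) => w M0 _ /=.
    by rewrite /abs_pow /powR normr_eq0 (gt_eqF M0)/= gtr0_norm.
- exact: measurable_funPT.
- by move=> x; rewrite lee_fin expR_ge0.
Qed.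

(** The constant c of the exponential scaling is identified at s = 1 as psi q;
    finiteness of the factor's moment is what allows the Laplace exponent to be
    evaluated at q. *)
Lemma abs_moment_power_law (q sg t0 : R) d' (W' : measurableType d')
    (P' : probability W' R) (L : R -> {RV P' >-> R}) (psi : R -> R) :
  (forall lam t, Lambda lam -> S t -> S (lam * t)) ->
  S t0 -> S 1 -> continuous_in_law P Lambda (fun lam => M lam t0) ->
  (forall s : R, 0 <= s -> Lambda (expR (sg * s))) ->
  (qinf P T X < q%:E)%E -> (q%:E < qsup P T X)%E ->
  eq_law P' (L 1) P (fun w => ln (M (expR sg) t0 w)) ->
  laplace_exponent P' L psi ->
  forall s : R, 0 <= s -> abs_moment P q (X (expR (sg * s))) =
    ((expR (s * psi q))%:E * abs_moment P q (X 1))%E.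
Proof.
move=> SM St0 S1 Mc Lsg qi qs law Lpsi s s0.
have := abs_moment_scaling q (Lsg _ s0) St0 S1; rewrite mulr1 => ->.
have [->|m1] := eqVneq (abs_moment P q (X 1)) 0%E; first by rewrite !mule0.
have [c gc] := abs_moment_exp_scaling SM St0 S1 Mc Lsg qi qs m1.
have Lsg1 : Lambda (expR sg) by have := Lsg 1 ler01; rewrite mulr1.
have := mmt_ln_abs_moment q Lsg1 St0 law.
have := gc 1 ler01; rewrite mulr1 mul1r => -> mmt.
have := Lpsi q 1 ler01; rewrite mmt mul1r ltry => /(_ isT) [] /expR_inj cpsi.
by rewrite gc// cpsi.
Qed.

End ScalingOfMoments.

Theorem proposition3p3 (R : realType)
    (d : measure_display) (W : measurableType d) (P : probability W R)
    (T Lambda S : set R)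
    (X : R -> {RV P >-> R}) (M : R -> R -> {RV P >-> R})
    (d' : measure_display) (W' : measurableType d') (P' : probability W' R)
    (L : R -> {RV P' >-> R}) (psi : R -> R) (t0 : R) :
  is_time_set T ->
  not_identically_null P T X ->
  admissible_scales Lambda S ->
  multifractal_with P T X Lambda S M ->
  (0 < qsup P T X)%E ->
  S t0 ->
  continuous_in_law P Lambda (fun lam => M lam t0) ->
  S 1 ->
  levy_process P' L ->
  (Lambda = `]0, 1]%classic ->
     eq_law P' (L 1) P (fun w => ln (M (expR (-1)) t0 w))) ->
  (Lambda = `[1, +oo[%classic ->
     eq_law P' (L 1) P (fun w => ln (M (expR 1) t0 w))) ->
  laplace_exponent P' L psi ->
  forall q : R, (qinf P T X < q%:E)%E -> (q%:E < qsup P T X)%E ->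
  (Lambda = `]0, 1]%classic -> forall t : R, 0 < t -> t <= 1 ->
     abs_moment P q (X t) = ((t `^ (- psi q))%:E * abs_moment P q (X 1%R))%E) /\
  (Lambda = `[1, +oo[%classic -> forall t : R, 1 <= t ->
     abs_moment P q (X t) = ((t `^ psi q)%:E * abs_moment P q (X 1%R))%E).
Proof.
move=> _ _ [_ SM] XM _ St0 Mc S1 _ law_le1 law_ge1 Lpsi q qi qs.
split=> [LE t t_gt0 t1|LE t t1].
- have Lsg s : 0 <= s -> Lambda (expR (-1 * s)).
    by move=> s0; rewrite LE/= in_itv/= mulN1r expR_gt0 -[leRHS]expR0 ler_expR
      oppr_le0.
  have := abs_moment_power_law XM SM St0 S1 Mc Lsg qi qs (law_le1 LE) Lpsi.
  move=> /(_ (- ln t)); rewrite oppr_ge0 ln_le0// => /(_ isT).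
  by rewrite mulrNN mul1r lnK ?posrE// /powR gt_eqF// !mulNr [ln t * _]mulrC.
- have t_gt0 : 0 < t by exact: lt_le_trans t1.
  have Lsg s : 0 <= s -> Lambda (expR (1 * s)).
    by move=> s0; rewrite LE/= in_itv/= andbT -[leLHS]expR0 ler_expR mul1r.
  have := abs_moment_power_law XM SM St0 S1 Mc Lsg qi qs (law_ge1 LE) Lpsi.
  move=> /(_ (ln t)); rewrite ln_ge0// => /(_ isT).
  by rewrite mul1r lnK ?posrE// /powR gt_eqF// [ln t * _]mulrC.
Qed.
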